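(* Let $p=2q+1\ge 3$ be an odd integer coprime to $3$, let $T=[(x_1,y_1),\dots,(x_q,y_q)]$ be a starter (not necessarily strong) in $\mathbb{Z}_p$ (with its pairs and the elements inside pairs listed in some fixed order), and let $\hat T=\{x_i+y_i: 1\le i\le q\}\subseteq\mathbb{Z}_p$ be its set of pair sums. If $t\in\mathbb{Z}_p$ is either $0$ or an element of $\hat T$, then the modular Sudoku problem associated with $(T,t)$ does not have a solution. In other words, the condition $t\notin\hat T\cup\{0\}$ is necessary for solvability of the modular Sudoku problem associated with $(T,t)$.
   Context: Starters. For odd $n\ge 3$, $\mathbb{Z}_n=\mathbb{Z}/n\mathbb{Z}$ and $\mathbb{Z}_n^*=\mathbb{Z}_n\setminus\{0\}$. A starter in $\mathbb{Z}_n$ (of order $n$) is a partition of $\mathbb{Z}_n^*$ into $k=(n-1)/2$ pairs $\{a_i,b_i\}$, $i=1,\dots,k$, such that the differences $\pm(a_i-b_i)$, $i=1,\dots,k$, comprise all of $\mathbb{Z}_n^*$. It is strong if the $k$ sums $a_i+b_i\in\mathbb{Z}_n$ are pairwise distinct and all nonzero. Extension. Given $T=[(x_1,y_1),\dots,(x_q,y_q)]$ with entries in $\mathbb{Z}_p$, $p=2q+1$, and a key $t\in\mathbb{Z}_p$, the extension of $T$ with key $t$ is the tuple $\Sigma_p=[(u_i,v_i)]_{i=0}^{3q}$ of ordered pairs in $\mathbb{Z}_p$ given by $(u_0,v_0)=(t,t)$ and, for $1\le i\le q$, $(u_{3i-2},v_{3i-2})=(x_i,y_i)$, $(u_{3i-1},v_{3i-1})=(t+x_i,t+y_i)$,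 $(u_{3i},v_{3i})=(t-y_i,t-x_i)$. The three pairs with indices $3i-2,3i-1,3i$ form the $i$-th regular row. Weak sets. For $s\in\mathbb{Z}_p$ let $W_s=\{\ell\in\{0,\dots,3q\}: u_\ell+v_\ell=s \text{ in }\mathbb{Z}_p\}$. $W_s$ is called a weak set if $s=0$ or $|W_s|>1$. Monochrome sets. The position $\langle i,0\rangle$ refers to the entry $u_i$ and $\langle i,1\rangle$ to the entry $v_i$, $0\le i\le 3q$. For $c\in\mathbb{Z}_p$ the monochrome set $M_c$ is the set of positions whose entry in $\Sigma_p$ equals $c$. Modular Sudoku problem associated with $(T,t)$: find $U_i,V_i\in\{0,1,2\}$, $0\le i\le 3q$ (regarded as residues modulo $3$, with $U_i$ in position $\langle i,0\rangle$ and $V_i$ in position $\langle i,1\rangle$), such that: (1) Row constraints: for each $i=1,\dots,q$ the differences $U_j-V_j \bmod 3$, $j=3i-2,3i-1,3i$, are pairwise distinct. (2) Weak set constraints: for each weak set $W_s$ with $s\ne0$, the sums $U_i+V_i\bmod 3$, $i\in W_s$, are pairwise distinct; and the sums $U_i+V_i\bmod 3$, $i\in W_0$, are pairwise distinct and nonzero. (3) Color constraints: for each $c\in\mathbb{Z}_p$, $c\neq0$, the values of the unknowns in the positions belonging to $M_c$ are pairwise distinct; and the values of the unknowns in the positions belonging to $M_0$ are pairwise distinct and nonzero. *)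

(* Defs.v *)
From mathcomp Require Import all_boot all_algebra.
Set Implicit Arguments.
Unset Strict Implicit.
Unset Printing Implicit Defensive.
Import GRing.Theory.
Local Open Scope ring_scope.

(* 'Z_n has n elements only for n > 1, and the number k of pairs is not tied
   to n here: these definitions are meant for odd n >= 3 and n = 2k + 1. *)

Definition pair_set (n : nat) (xy : 'Z_n * 'Z_n) : {set 'Z_n} :=
  [set xy.1; xy.2].

(* The first three clauses say that T lists, without repetition, the blocks of
   a partition of the nonzero residues into 2-element sets; the order of the
   pairs and the order inside each pair are arbitrary. *)
Definition is_starter (n k : nat) (T : k.-tuple ('Z_n * 'Z_n)) : Prop :=
  [/\ partition [set pair_set (tnth T i) | i : 'I_k] [set~ 0],
      forall i : 'I_k, (tnth T i).1 != (tnth T i).2,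
      injective (fun i : 'I_k => pair_set (tnth T i))
    & [set (tnth T i).1 - (tnth T i).2 | i : 'I_k]
        :|: [set - ((tnth T i).1 - (tnth T i).2) | i : 'I_k] = [set~ 0]].

Definition pair_sums (n k : nat) (T : k.-tuple ('Z_n * 'Z_n)) : {set 'Z_n} :=
  [set (tnth T i).1 + (tnth T i).2 | i : 'I_k].

(* The pairs of T are numbered from 0, so the pair number i > 0 of a
   1-based numbering, which yields the entries 3i-2, 3i-1 and 3i, is the entry
   i-1 = (l-1) %/ 3 of T for each of these three values of l; see
   [extension_row]. *)
Definition extension (p q : nat) (T : q.-tuple ('Z_p * 'Z_p)) (t : 'Z_p) :
    ((3 * q).+1).-tuple ('Z_p * 'Z_p) :=
  [tuple if val l == 0%N then (t, t) else
         let: (x, y) := nth (0, 0) T (l.-1 %/ 3) in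
         match (l.-1 %% 3)%N with
         | 0 => (x, y)
         | 1 => (t + x, t + y)
         | _ => (t - y, t - x)
         end
  | l < (3 * q).+1].

Lemma extension0 (p q : nat) (T : q.-tuple ('Z_p * 'Z_p)) (t : 'Z_p) :
  tnth (extension T t) ord0 = (t, t).
Proof. by rewrite tnth_mktuple. Qed.

Lemma extension_row (p q : nat) (T : q.-tuple ('Z_p * 'Z_p)) (t : 'Z_p)
    (i : nat) (j : 'I_(3 * q).+1) :
    (1 <= i <= q)%N ->
  let x := (nth (0, 0) T i.-1).1 in
  let y := (nth (0, 0) T i.-1).2 in
  [/\ val j = (3 * i - 2)%N -> tnth (extension T t) j = (x, y),
      val j = (3 * i - 1)%N -> tnth (extension T t) j = (t + x, t + y)
    & val j = (3 * i)%N -> tnth (extension T t) j = (t - y, t - x)].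
Proof.
case: i => [//|i] _ /=; rewrite tnth_mktuple /=.
have E r : (r < 3)%N ->
    ((i * 3 + r) %/ 3 = i)%N /\ ((i * 3 + r) %% 3 = r)%N.
  by move=> lr; rewrite divnMDl // divn_small // addn0 modnMDl modn_small.
have [S1 S2 S3] : [/\ 3 * i.+1 - 2 = (i * 3 + 0).+1,
    3 * i.+1 - 1 = (i * 3 + 1).+1 & 3 * i.+1 = (i * 3 + 2).+1]%N.
  by rewrite mulnC mulSn addn0 addn1 addn2 -!addnBAC.
by split=> ->; rewrite ?S1 ?S2 ?S3 /=;
  [have [-> ->] := E 0%N isT | have [-> ->] := E 1%N isT
  | have [-> ->] := E 2 isT]; case: (nth _ _ _).
Qed.

Definition regular_row (q : nat) (i : nat) : {set 'I_(3 * q).+1} :=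
  [set j : 'I_(3 * q).+1 | val j \in [:: 3 * i - 2; 3 * i - 1; 3 * i]%N].

Definition sum_class (p q : nat) (T : q.-tuple ('Z_p * 'Z_p)) (t s : 'Z_p) :
    {set 'I_(3 * q).+1} :=
  [set l | (tnth (extension T t) l).1 + (tnth (extension T t) l).2 == s].

Definition is_weak (p q : nat) (T : q.-tuple ('Z_p * 'Z_p)) (t s : 'Z_p) : bool :=
  (s == 0) || (1 < #|sum_class T t s|)%N.

(* (i, false) is the position of the first component of the i-th pair, and
   (i, true) that of the second one. *)
Definition position (q : nat) : finType := ('I_(3 * q).+1 * bool)%type.

Definition at_position (q : nat) (A : Type) (u v : 'I_(3 * q).+1 -> A)
    (P : position q) : A :=
  if P.2 then v P.1 else u P.1.

Definition monochrome (p q : nat) (T : q.-tuple ('Z_p * 'Z_p)) (t c : 'Z_p) :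
    {set position q} :=
  [set P | at_position (fun l => (tnth (extension T t) l).1)
                       (fun l => (tnth (extension T t) l).2) P == c].

Definition row_constraints (q : nat) (U V : 'I_(3 * q).+1 -> 'Z_3) : Prop :=
  forall i : nat, (1 <= i <= q)%N ->
    {in regular_row q i &, injective (fun j => U j - V j)}.

Definition weak_set_constraints (p q : nat) (T : q.-tuple ('Z_p * 'Z_p))
    (t : 'Z_p) (U V : 'I_(3 * q).+1 -> 'Z_3) : Prop :=
  [/\ forall s : 'Z_p, is_weak T t s -> s != 0 ->
        {in sum_class T t s &, injective (fun l => U l + V l)},
      {in sum_class T t 0 &, injective (fun l => U l + V l)}
    & {in sum_class T t 0, forall l, U l + V l != 0}].

Definition color_constraints (p q : nat) (T : q.-tuple ('Z_p * 'Z_p))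
    (t : 'Z_p) (U V : 'I_(3 * q).+1 -> 'Z_3) : Prop :=
  [/\ forall c : 'Z_p, c != 0 ->
        {in monochrome T t c &, injective (at_position U V)},
      {in monochrome T t 0 &, injective (at_position U V)}
    & {in monochrome T t 0, forall P, at_position U V P != 0}].

Definition sudoku_solution (p q : nat) (T : q.-tuple ('Z_p * 'Z_p))
    (t : 'Z_p) (U V : 'I_(3 * q).+1 -> 'Z_3) : Prop :=
  [/\ row_constraints U V, weak_set_constraints T t U V
    & color_constraints T t U V].

(* Main.v *)
Require Import Defs.
From mathcomp Require Import all_boot all_algebra.
Import GRing.Theory.
Local Open Scope ring_scope.

(** Two nonzero residues modulo 3 are equal or opposite
    ([Z3_nonzero_eq_or_opp]), and each of the two kinds of key forces a pair of
    nonzero residues that are neither.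

    If [t = 0], the initial pair [(t, t)] is [(0, 0)]: both its unknowns have
    color 0, so they are nonzero and distinct, hence opposite; but the sum of
    the pair is 0 too, so the sum of the unknowns must not vanish.

    If [t = x + y] for a pair [(x, y)] of the starter, then
    [(t - y, t - x) = (x, y)]: the first and the third pair of the regular row
    of [(x, y)] coincide.  Let [d] and [e] be the differences of the unknowns of
    these two pairs, for the first and the second component.  The colors [x]
    and [y] give [d != 0] and [e != 0], the row constraint gives [d != e], and,
    both pairs having sum [t], the weak set of [t] gives [d + e != 0]. *)

Lemma Z3_nonzero_eq_or_opp {a b : 'Z_3} :
  a != 0 -> b != 0 -> a = b \/ a + b = 0.
Proof.
by case: a b => [[|[|[|a]]] ha] [[|[|[|b]]] hb] //= _ _;
  [left | right | right | left]; apply/val_inj.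
Qed.

(** Two equal pairs of the extension that lie in the same regular row leave no
    admissible values: their unknowns must differ in each component by the color
    constraints, in the difference by the row constraint, and in the sum by the
    weak set constraint, which is one condition too many modulo 3. *)
Lemma no_solution_repeated_pair (p q : nat) (T : q.-tuple ('Z_p * 'Z_p))
    (t : 'Z_p) (U V : 'I_(3 * q).+1 -> 'Z_3) (i : nat) (a b : 'I_(3 * q).+1) :
    (1 <= i <= q)%N -> a \in regular_row q i -> b \in regular_row q i ->
    a != b -> tnth (extension T t) a = tnth (extension T t) b ->
  ~ sudoku_solution T t U V.
Proof.
move=> iq ra rb /eqP nab eab [row [weak weak0 _] [color color0 _]].
have colorP P Q :
    at_position (fun l => (tnth (extension T t) l).1)
                (fun l => (tnth (extension T t) l).2) P =
    at_position (fun l => (tnth (extension T t) l).1)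
                (fun l => (tnth (extension T t) l).2) Q ->
    at_position U V P = at_position U V Q -> P = Q.
  move=> ePQ; set c := at_position _ _ Q in ePQ.
  have mP : P \in monochrome T t c by rewrite inE ePQ.
  have mQ : Q \in monochrome T t c by rewrite inE.
  have [c0|c0] := eqVneq c 0; last exact: color c c0 _ _ mP mQ.
  by rewrite c0 in mP mQ; apply: color0.
have nU : U a - U b != 0.
  rewrite subr_eq0; apply/eqP => e; apply: nab.
  by have [] := colorP (a, false) (b, false) (congr1 fst eab) e.
have nV : V a - V b != 0.
  rewrite subr_eq0; apply/eqP => e; apply: nab.
  by have [] := colorP (a, true) (b, true) (congr1 snd eab) e.
have [e|e] := Z3_nonzero_eq_or_opp nU nV.
  apply: nab; apply: (row i iq a b ra rb).
  by apply/eqP; rewrite -subr_eq0 opprD addrACA -opprD e subrr.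
have eS : U a + V a = U b + V b.
  by apply/eqP; rewrite -subr_eq0 opprD addrACA e.
set s := (tnth (extension T t) b).1 + (tnth (extension T t) b).2.
have sa : a \in sum_class T t s by rewrite inE eab.
have sb : b \in sum_class T t s by rewrite inE.
have [s0|s0] := eqVneq s 0.
  by rewrite s0 in sa sb; apply: nab; apply: weak0.
have ws : is_weak T t s.
  apply/orP; right; apply/card_gt1P; exists a, b.
  by split=> //; apply/eqP.
exact: nab (weak s ws s0 _ _ sa sb eS).
Qed.

Lemma no_solution_key0 (p q : nat) (T : q.-tuple ('Z_p * 'Z_p))
    (U V : 'I_(3 * q).+1 -> 'Z_3) :
  ~ sudoku_solution T 0 U V.
Proof.
case=> _ [_ _ sum0] [_ inj0 color0].
have m0 b : (ord0, b) \in monochrome T 0 0.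
  by rewrite inE /at_position /= !extension0; case: b.
have [e|e] := Z3_nonzero_eq_or_opp (color0 _ (m0 false)) (color0 _ (m0 true)).
  by have := inj0 _ _ (m0 false) (m0 true) e.
have /sum0 : ord0 \in sum_class T 0 0 by rewrite inE extension0 /= addr0.
by rewrite (e : U ord0 + V ord0 = 0) eqxx.
Qed.

Lemma no_solution_key_pair_sum (p q : nat) (T : q.-tuple ('Z_p * 'Z_p))
    (t : 'Z_p) (U V : 'I_(3 * q).+1 -> 'Z_3) :
  t \in pair_sums T -> ~ sudoku_solution T t U V.
Proof.
case/imsetP=> j _ et.
have iq : (1 <= j.+1 <= q)%N by rewrite ltn_ord.
have lb : (3 * j.+1 < (3 * q).+1)%N by rewrite ltnS leq_mul2l ltn_ord orbT.
have la : (3 * j.+1 - 2 < (3 * q).+1)%N by apply: leq_ltn_trans lb; apply: leq_subr.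
have [/(_ erefl) ea _ _] := extension_row T t (Ordinal la) iq.
have [_ _ /(_ erefl) eb] := extension_row T t (Ordinal lb) iq.
apply: (@no_solution_repeated_pair _ _ _ _ _ _ j.+1 (Ordinal la) (Ordinal lb) iq).
- by rewrite inE /= !inE eqxx.
- by rewrite inE /= !inE eqxx !orbT.
- by rewrite -val_eqE /= neq_ltn ltn_subrL muln_gt0.
by rewrite ea eb /= et (tnth_nth (0, 0)) addrK [X in X - _]addrC addrK.
Qed.

Theorem theorem2 (p q : nat) (T : q.-tuple ('Z_p * 'Z_p)) (t : 'Z_p)
    (hpq : p = (2 * q + 1)%N) (hp3 : (3 <= p)%N) (hp : coprime p 3)
    (hT : is_starter T) (ht : t = 0 \/ t \in pair_sums T) :
  ~ exists U V : 'I_(3 * q).+1 -> 'Z_3, sudoku_solution T t U V.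
Proof.
case=> U [V]; case: ht => [->|]; first exact: no_solution_key0.
exact: no_solution_key_pair_sum.
Qed.
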